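(* Let $A\subset \mathbb{R}$ be a finite set with $|A|\ge 2$ and let $\delta_1 = 2/5$. Then there are two disjoint subsets $B$ and $C$ of $A$ such that $A = B\sqcup C$ and $$\max\{\mathsf{E}^{+}_3 (B), \mathsf{E}^{\times}_3 (C)\} \lesssim |A|^{4-\delta_1}.$$ Besides, this inequality cannot hold with $\delta_1$ replaced by any number greater than $3/4$; that is, for every $\delta>3/4$ and all constants $K,c>0$ there is a finite set $A\subset\mathbb{R}$ such that for every partition $A=B\sqcup C$ one has $\max\{\mathsf{E}^{+}_3 (B), \mathsf{E}^{\times}_3 (C)\} > K|A|^{4-\delta}(\log|A|)^c$.
   Context: For a finite set $X\subset\mathbb{R}$, $\mathsf{E}^{+}_3(X)$ is the number of tuples $(x_1,x_1',x_2,x_2',x_3,x_3')\in X^6$ with $x_1-x_1'=x_2-x_2'=x_3-x_3'$, and $\mathsf{E}^{\times}_3(X)=\sum_{\lambda\in\mathbb{R}\setminus\{0\}} r(\lambda)^3$ where $r(\lambda)=|\{(x,x')\in X^2: x=\lambda x'\}|$ (the multiplicative analogue, counting solutions of $x_1/x_1'=x_2/x_2'=x_3/x_3'$). The notation $a\lesssim b$ means $a\le K\, b\,(\log|A|)^c$ for some absolute constants $K,c>0$. Logarithms are base 2. *)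

(* Defs.v *)
From HB Require Import structures.
From mathcomp Require Import all_boot all_order all_algebra finmap.
From mathcomp Require Import all_classical all_reals all_analysis.

Set Implicit Arguments.
Unset Strict Implicit.
Unset Printing Implicit Defensive.

Import Order.TTheory GRing.Theory Num.Theory.

Local Open Scope fset_scope.
Local Open Scope classical_set_scope.
Local Open Scope ring_scope.

Definition energy3_add (R : realType) (X : {fset R}) : nat :=
  #|` [fset t in ((X `*` X) `*` (X `*` X) `*` (X `*` X))%fset |
        (t.1.1.1 - t.1.1.2 == t.1.2.1 - t.1.2.2) &&
        (t.1.2.1 - t.1.2.2 == t.2.1 - t.2.2)]%fset |.

Definition mult_rep (R : realType) (X : {fset R}) (l : R) : nat :=
  #|` [fset p in (X `*` X)%fset | p.1 == l * p.2]%fset |.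

(* The sum runs over all nonzero reals, so it is taken in the extended reals:
   it is finite when 0 is not in X, and +oo when 0 is in X, because the pair
   (0, 0) then contributes to every l. *)
Definition energy3_mul (R : realType) (X : {fset R}) : \bar R :=
  (\esum_(l in [set l : R | l != 0%R]) ((mult_rep X l ^ 3)%N%:R)%:E)%E.

Definition log2 (R : realType) (x : R) : R := ln x / ln 2.

(* Main.v *)
(* Let n = |A|.  For a in B and a difference x let rho_B(x) be the number of a
   in B with a - x in A, and F(B) the sum of rho_B(x)^3.  If C is a subset of
   A \ {0} with E*_3(C) = E, let P be a dyadic level set of popular ratios and C'
   the set of those a in C that have about equally many representations
   a = l c with l in P, c in C.  A popular difference x of C' and A then gives
   many incidences l c - x = b between the lines y = l c - x and the grid A x A,
   and a Szemeredi-Trotter bound yields F(C') << (n^4 / E) |C'|^3 up to logarithms.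
   For a Cartesian product this bound is elementary: cut the grid into cells
   by rank and count pairs of points in the same cell.
   By convexity the condition F(B) <= M |B|^3 is stable under disjoint unions,
   so a maximal B satisfying it leaves a complement with small E*_3.

   For the lower bound take A = {(2i+1) 2^k : i < J^3, k < J}: a half of A has
   many coincident differences within the layers of fixed k, or many
   coincident ratios 2^v. *)
Require Import Defs.
From HB Require Import structures.
From mathcomp Require Import all_boot all_order all_algebra finmap.
From mathcomp Require Import all_classical all_reals all_analysis.
From mathcomp Require Import zify ring lra.

Set Implicit Arguments.
Unset Strict Implicit.
Unset Printing Implicit Defensive.

Import Order.TTheory GRing.Theory Num.Theory.

Local Open Scope ring_scope.

(** * Double counting and pigeonholing over lists *)

Lemma sum_count_exchange (S T : Type) (s : seq S) (t : seq T)
    (r : S -> T -> bool) :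
  (\sum_(x <- s) count (r x) t = \sum_(y <- t) count (r^~ y) s)%N.
Proof.
under eq_bigr do rewrite -sum1_count big_mkcond.
rewrite exchange_big /=; apply: eq_bigr => y _.
by rewrite -big_mkcond sum1_count.
Qed.

Lemma count_mem_inj (S T : eqType) (s : seq S) (t : seq T) (f : S -> T) :
  uniq s -> {in s &, injective f} -> (count (fun x => f x \in t) s <= size t)%N.
Proof.
move=> us injf; rewrite -size_filter -(size_map f).
apply: uniq_leq_size => [|y /mapP[x]].
  rewrite map_inj_in_uniq ?filter_uniq// => x y.
  by rewrite !mem_filter => /andP[_ xs] /andP[_ ys]; exact: injf.
by rewrite mem_filter => /andP[fx _] ->.
Qed.

Lemma leq_sum_seq_const (T : eqType) (s : seq T) (f : T -> nat) (c : nat) :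
  {in s, forall x, (f x <= c)%N} -> (\sum_(x <- s) f x <= size s * c)%N.
Proof.
move=> fc; rewrite -sum1_size big_distrl /= !big_seq.
by apply: leq_sum => x xs; rewrite mul1n fc.
Qed.

Lemma geq_sum_seq_const (T : eqType) (s : seq T) (f : T -> nat) (c : nat) :
  {in s, forall x, (c <= f x)%N} -> (size s * c <= \sum_(x <- s) f x)%N.
Proof.
move=> fc; rewrite -sum1_size big_distrl /= !big_seq.
by apply: leq_sum => x xs; rewrite mul1n fc.
Qed.

(** The nonzero values are sorted by their binary logarithm, and the best of the [L] scales carries
    at least a fraction [1/L] of the sum. The factor [2 ^ k] pays for rounding [f x] down to a power
    of two. Counting the whole superlevel set instead of one dyadic class only enlarges the bound;
    later arguments use only [2 ^ j <= f x]. *)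
Lemma dyadic_pigeonhole (T : eqType) (s : seq T) (f : T -> nat) (k L : nat) :
  (0 < k)%N -> (0 < L)%N -> {in s, forall x, (f x < 2 ^ L)%N} ->
  exists j, (\sum_(x <- s) f x ^ k <=
     2 ^ k * L * ((2 ^ j) ^ k * count (fun x => (2 ^ j <= f x)%N) s))%N.
Proof.
move=> k0 L0 fL.
pose g (j : nat) := ((2 ^ j) ^ k * count (fun x => (2 ^ j <= f x)%N) s)%N.
have [j0 _ jmax] := @arg_maxnP 'I_L (Ordinal L0) xpredT (fun j => g j) isT.
exists j0.
apply: (@leq_trans (2 ^ k * \sum_(j < L) g j)%N); last first.
  rewrite -mulnA leq_mul2l; apply/orP; right.
  apply: (@leq_trans (\sum_(j < L) g j0)%N); first by apply: leq_sum => j _; exact: jmax.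
  by rewrite sum_nat_const card_ord.
rewrite /g big_distrr /=.
under [leqRHS]eq_bigr do rewrite -sum1_count big_mkcond /= mulnA big_distrr /=.
rewrite exchange_big /= !big_seq; apply: leq_sum => x xs.
have [->|fx0] := posnP (f x); first by rewrite exp0n.
have /andP[lo up] := trunc_log_bounds (ltnSn 1) fx0.
have jL : (trunc_log 2 (f x) < L)%N.
  by rewrite -(ltn_exp2l _ _ (ltnSn 1)); exact: leq_ltn_trans lo (fL _ xs).
rewrite (bigD1 (Ordinal jL)) //= lo muln1.
apply: leq_trans (leq_addr _ _).
by rewrite -expnMn -expnS leq_exp2r// ltnW.
Qed.

(** Keep one element for each value of [k], at most [N] in all. Every other element shares its value
    with one further down the list, so it contributes to the collision sum. *)
Lemma size_le_collisions (T : eqType) (k : T -> nat) (N : nat) (l : seq T) :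
  uniq l -> {in l, forall a, (k a < N)%N} ->
  (size l <= N + \sum_(a <- l) count (fun b => (a != b) && (k a == k b)) l)%N.
Proof.
move=> ul kN.
have sz : (size (undup (map k l)) <= N)%N.
  rewrite -(size_iota 0 N); apply: uniq_leq_size; first exact: undup_uniq.
  by move=> v; rewrite mem_undup mem_iota => /mapP[a al ->]; rewrite kN.
apply: leq_trans (leq_add sz (leqnn _)) => {kN sz N}.
elim: l ul => [//|a l IH] /= /andP[al ul].
rewrite big_cons /= eqxx /= add0n.
have := IH ul.
set S := (\sum_(a <- l) _)%N; set S' := (\sum_(j <- l) _)%N.
have SS' : (S <= S')%N by apply: leq_sum => b _; rewrite leq_addl.
case: ifPn => [/mapP[b bl kab]|_] /=; last by lia.
suff : (0 < count (fun b0 => (a != b0) && (k a == k b0)) l)%N by lia.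
rewrite -has_count; apply/hasP; exists b => //; rewrite kab eqxx andbT.
by apply: contraNneq al => ->.
Qed.

(** * Incidences between lines and a Cartesian grid *)

Section Grid.
Variables (R : realFieldType) (A : seq R) (m s : nat).
Hypotheses (uA : uniq A) (m0 : (0 < m)%N) (Asm : (size A <= s * m)%N).

(** Cutting by rank rather than by length makes every cell hold at most [m] elements of [A], however
    [A] is spaced. *)
Definition rank_in (a : R) := count (fun b => b < a) A.
Definition cell (a : R) := (rank_in a %/ m)%N.

Lemma rank_in_le a b : a <= b -> (rank_in a <= rank_in b)%N.
Proof. by move=> ab; apply: sub_count => c /= ca; exact: lt_le_trans ca ab. Qed.

Lemma rank_in_lt a b : a \in A -> a < b -> (rank_in a < rank_in b)%N.
Proof.
move=> aA ab; rewrite /rank_in.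
have -> : count (fun c => c < b) A =
    (count (fun c => (c < a)%R) A + count (fun c => (a <= c)%R && (c < b)%R) A)%N.
  rewrite -count_predUI addnC [X in (X + _)%N](_ : _ = 0%N); last first.
    by apply/eqP; rewrite -leqn0 leqNgt -has_count; apply/hasP => -[c _] /=; case: ltP.
  rewrite add0n; apply: eq_count => c /=.
  by case: (ltP c a) => //= ca; rewrite (lt_trans ca ab).
rewrite -addn1 leq_add2l -has_count; apply/hasP; exists a => //.
by rewrite lexx ab.
Qed.

Lemma cell_le a b : a <= b -> (cell a <= cell b)%N.
Proof. by move=> ab; apply: leq_div2r; exact: rank_in_le. Qed.

Lemma cell_lt a : a \in A -> (cell a < s)%N.
Proof.
move=> aA; rewrite /cell ltn_divLR//; apply: leq_trans Asm.
rewrite /rank_in ltn_neqAle count_size andbT -all_count.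
by apply/allPn; exists a; rewrite // ltxx.
Qed.

Lemma count_cell i : (count (fun a => cell a == i) A <= m)%N.
Proof.
rewrite -size_filter -(size_map rank_in) -(size_iota (i * m) m).
apply: uniq_leq_size => [|r /mapP[a]].
  rewrite map_inj_in_uniq ?filter_uniq// => a b.
  rewrite !mem_filter => /andP[_ aA] /andP[_ bA] e.
  by case: (ltgtP a b) => // ab; have := rank_in_lt _ ab; rewrite ?aA ?bA e ltnn => /(_ isT).
rewrite mem_filter mem_iota => /andP[/eqP <- aA] ->.
rewrite /cell leq_divM /=; have := divn_eq (rank_in a) m.
have := ltn_pmod (rank_in a) m0; lia.
Qed.

(** Column index plus row index is monotone along the line, takes fewer than [2 * s] values and
    determines the cell. Hence all but [2 * s] of the points on the line are paid for by pairs of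
    points in a common cell. *)
Lemma line_collisions (l c : R) : l != 0 ->
  (count (fun a => (l * a - c)%R \in A) A <= 2 * s +
   \sum_(a <- A) count (fun b => [&& a != b, cell a == cell b,
      (l * a - c)%R \in A, (l * b - c)%R \in A &
      cell (l * a - c)%R == cell (l * b - c)%R]) A)%N.
Proof.
move=> l0; pose on a := (l * a - c)%R \in A.
(* For negative slope the row index is reversed, so that it increases along the line as the column
   index does. *)
pose h a := if 0 < l then cell (l * a - c) else (s.-1 - cell (l * a - c))%N.
have hle a b : a <= b -> (h a <= h b)%N.
  move=> ab; rewrite /h; case: ltP => [lp|ln].
    by apply: cell_le; rewrite lerD2r ler_pM2l.
  by apply: leq_sub2l; apply: cell_le; rewrite lerD2r ler_wnM2l.
(* Both summands are monotone in [a], so equal sums force equal summands. *)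
pose k a := (cell a + h a)%N.
have kE a b : k a = k b -> cell a = cell b /\ h a = h b.
  rewrite /k; case: (lerP a b) => [ab|/ltW ab];
  have := cell_le ab; have := hle _ _ ab; lia.
have := @size_le_collisions _ k (2 * s) (seq.filter on A).
rewrite filter_uniq// size_filter => /(_ isT) H.
apply: leq_trans (H _) _.
  move=> a; rewrite mem_filter => /andP[/cell_lt cy /cell_lt cx].
  rewrite /k /h; case: ifP => _; lia.
rewrite leq_add2l big_filter big_mkcond /=; apply: leq_sum => a _.
case: ifPn => // ona; rewrite count_filter; apply: sub_count => b /=.
move=> /andP[/andP[-> /eqP kab] onb]; rewrite -/(on a) -/(on b) ona onb /=.
have [-> hab] := kE _ _ kab; rewrite eqxx /=.
move: hab; rewrite /h; have := cell_lt ona; have := cell_lt onb.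
by case: ifP => _ h1 h2 h3; apply/eqP; lia.
Qed.

(* A line that is neither horizontal nor vertical is monotone, so it meets at
   most 2s of the s x s cells. *)
Lemma grid_incidences (Ls : seq (R * R)) : uniq Ls ->
  {in Ls, forall p, p.1 != 0} ->
  (\sum_(p <- Ls) count (fun a => (p.1 * a - p.2)%R \in A) A <=
   size Ls * (2 * s) + (size A * m) ^ 2)%N.
Proof.
move=> uL L0.
(* [N] counts ordered pairs of [A] in a common cell. The collision sum over all lines will be at
   most [N ^ 2]: one factor for the abscissae, one for the heights. *)
pose N := (\sum_(a <- A) count (fun b => cell a == cell b) A)%N.
have NE : (N <= size A * m)%N.
  apply: leq_sum_seq_const => a _.
  by under eq_count do rewrite eq_sym; exact: count_cell.
pose Q (p : R * R) a b := [&& a != b, cell a == cell b,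
      (p.1 * a - p.2)%R \in A, (p.1 * b - p.2)%R \in A &
      cell (p.1 * a - p.2)%R == cell (p.1 * b - p.2)%R].
apply: (@leq_trans (\sum_(p <- Ls) (2 * s + \sum_(a <- A) count (Q p a) A))%N).
  by rewrite !big_seq; apply: leq_sum => p /L0; exact: line_collisions.
rewrite big_split /= leq_add//; first by apply: leq_sum_seq_const.
rewrite exchange_big /=.
apply: (@leq_trans (\sum_(a <- A) (count (fun b => cell a == cell b) A * N))%N); last first.
  by rewrite -big_distrl /= -/N -mulnn leq_mul.
apply: leq_sum => a _; rewrite sum_count_exchange.
apply: (@leq_trans (\sum_(b <- A) if cell a == cell b then N else 0)%N); last first.
  rewrite -sum1_count big_distrl /= -big_mkcond /=.
  by under [leqRHS]eq_bigr do rewrite mul1n.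
apply: leq_sum => b _; rewrite /Q.
have [->|ab] := eqVneq a b; first by rewrite count_pred0.
have [cab|cab] := eqVneq (cell a) (cell b); last by rewrite count_pred0.
have -> : N = size [seq p <- [seq (a, b) | a <- A, b <- A] | cell p.1 == cell p.2].
  rewrite size_filter -sum1_count big_mkcond /= big_allpairs_dep /=.
  by apply: eq_bigr => x _; rewrite -sum1_count big_mkcond.
set S := [seq _ <- _ | _].
(* A line is determined by its heights over two distinct abscissae [a] and [b], so these lines
   inject into the [N] pairs of heights in a common cell. *)
apply: (@leq_trans (count (fun p => (p.1 * a - p.2, p.1 * b - p.2) \in S) Ls)).
  apply: sub_count => p /and5P[_ _ pa pb pab].
  by rewrite mem_filter /= pab; apply/allpairsP; exists (p.1 * a - p.2, p.1 * b - p.2).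
apply: count_mem_inj => // p q _ _ [e1 e2].
have e : (p.1 - q.1) * (a - b) = 0 by lra.
move/eqP: e; rewrite mulf_eq0 !subr_eq0 (negbTE ab) orbF => /eqP e.
case: p q e1 e2 e => [p1 p2] [q1 q2] /= e1 _ e; move: e1; rewrite e => e1.
by congr (_, _); lra.
Qed.
End Grid.

(** * Popular ratios of a set limit the differences of a subset *)

(** Here [tau], [q], [t] are the dyadic thresholds for ratios, elements and differences, and [p],
    [c], [x] the sizes of the sets reaching them. After multiplication by [q ^ 3], the incidence
    bound absorbs [x * (t * q) ^ 3]; what remains contains [(tau * p) ^ 3], which the second
    hypothesis turns back into [(q * c) ^ 3]. *)
Lemma rich_lines_arith (E F L1 n tau p q c t x : nat) :
  (0 < q)%N -> (E <= 2 ^ 3 * L1 * (tau ^ 3 * p))%N ->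
  (tau * p <= 2 * L1 * (q * c))%N -> (F <= 2 ^ 3 * L1 * (t ^ 3 * x))%N ->
  (x * (t * q) ^ 3 <= 512 * n ^ 4 * p ^ 2)%N ->
  (F * E <= 2 ^ 18 * L1 ^ 5 * n ^ 4 * c ^ 3)%N.
Proof.
move=> q0 hE hp hF hx.
have q30 : (0 < q ^ 3)%N by rewrite expn_gt0 q0.
rewrite -(leq_pmul2r q30).
apply: (@leq_trans (2 ^ 3 * L1 * (t ^ 3 * x) * (2 ^ 3 * L1 * (tau ^ 3 * p)) * q ^ 3)%N).
  by rewrite leq_mul// leq_mul.
rewrite [leqLHS](_ : _ = 64 * L1 ^ 2 * tau ^ 3 * p * (x * (t * q) ^ 3))%N; last by ring.
apply: (@leq_trans (64 * L1 ^ 2 * tau ^ 3 * p * (512 * n ^ 4 * p ^ 2))%N).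
  by rewrite leq_mul2l hx orbT.
rewrite [leqLHS](_ : _ = 64 * 512 * L1 ^ 2 * n ^ 4 * (tau * p) ^ 3)%N; last by ring.
apply: (@leq_trans (64 * 512 * L1 ^ 2 * n ^ 4 * (2 * L1 * (q * c)) ^ 3)%N).
  by rewrite leq_mul2l leq_exp2r// hp orbT.
by rewrite [leqLHS](_ : _ = 2 ^ 18 * L1 ^ 5 * n ^ 4 * c ^ 3 * q ^ 3)%N//; ring.
Qed.

(** The case where [t * q] is too small for the incidence bound. Multiplying by [q ^ 2] suffices:
    [x * t] and one factor [tau * p] are bounded trivially, the other two factors [tau * p] by the
    second hypothesis. *)
Lemma poor_lines_arith (E F L1 n tau p q c t x : nat) :
  (0 < q)%N -> (0 < L1)%N -> (0 < n)%N -> (E <= 2 ^ 3 * L1 * (tau ^ 3 * p))%N ->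
  (tau * p <= 2 * L1 * (q * c))%N -> (F <= 2 ^ 3 * L1 * (t ^ 3 * x))%N ->
  (t * q <= 4 * p)%N -> (x * t <= c * n)%N -> (tau * p <= n ^ 2)%N ->
  (F * E <= 2 ^ 18 * L1 ^ 5 * n ^ 4 * c ^ 3)%N.
Proof.
move=> q0 L0 n0 hE hp hF htq hxt hn.
have q20 : (0 < q ^ 2)%N by rewrite expn_gt0 q0.
rewrite -(leq_pmul2r q20).
apply: (@leq_trans (2 ^ 3 * L1 * (t ^ 3 * x) * (2 ^ 3 * L1 * (tau ^ 3 * p)) * q ^ 2)%N).
  by rewrite leq_mul// leq_mul.
rewrite [leqLHS](_ : _ = 64 * L1 ^ 2 * tau ^ 3 * p * (x * t * (t * q) ^ 2))%N; last by ring.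
apply: (@leq_trans (64 * L1 ^ 2 * tau ^ 3 * p * (c * n * (4 * p) ^ 2))%N).
  by rewrite leq_mul2l leq_mul ?orbT// leq_exp2r.
rewrite [leqLHS](_ : _ = 2 ^ 10 * L1 ^ 2 * c * n * (tau * p * (tau * p) ^ 2))%N; last by ring.
apply: (@leq_trans (2 ^ 10 * L1 ^ 2 * c * n * (n ^ 2 * (2 * L1 * (q * c)) ^ 2))%N).
  by rewrite leq_mul2l leq_mul ?orbT// leq_exp2r.
rewrite [leqLHS](_ : _ = 2 ^ 12 * (L1 ^ 4 * n ^ 3) * (c ^ 3 * q ^ 2))%N; last by ring.
rewrite [leqRHS](_ : _ = 2 ^ 18 * (L1 ^ 5 * n ^ 4) * (c ^ 3 * q ^ 2))%N; last by ring.
by rewrite leq_mul// leq_mul ?leq_exp2l// leq_mul// leq_pexp2l.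
Qed.

Section KeyProposition.
Variables (R : realFieldType) (A : seq R).
Hypothesis uA : uniq A.

Definition diff_rep (B : seq R) (x : R) := count (fun a => a - x \in A) B.
Definition ratio_rep (C : seq R) (l : R) := count (fun a => a / l \in C) C.

Lemma rich_lines (C C' P X : seq R) (t q : nat) :
  {subset C <= A} -> uniq C -> uniq C' -> {subset C' <= C} -> uniq P -> uniq X ->
  {in P, forall l, l != 0} ->
  {in C', forall a, (q <= count (fun l => (a / l)%R \in C) P)%N} ->
  {in X, forall x, (t <= diff_rep C' x)%N} -> 
  (4 * size P <= t * q)%N -> (0 < size P)%N -> (t * q <= size A * size P)%N ->
  (size X * (t * q) ^ 3 <= 512 * size A ^ 4 * size P ^ 2)%N.
Proof.
move=> CA uC uC' C'C uP uX P0 qC tX tq P_gt0 tqn.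
set n := size A in tqn *; set p := size P in tq P_gt0 tqn *.
(* With this [s] the term [2 * s] per line accounts for at most half of the incidences, so the term
   [(n * m) ^ 2] must account for the other half. *)
pose s := (t * q %/ (4 * p))%N.
have s0 : (0 < s)%N by rewrite divn_gt0 ?muln_gt0.
have sn : (s <= n)%N.
  by rewrite -ltnS ltn_divLR ?muln_gt0//; nia.
pose m := (n %/ s).+1.
have nsm : (n <= s * m)%N by rewrite mulnC ltnW// ltn_ceil.
have msn : (m * s <= 2 * n)%N by rewrite /m mulSn mul2n -addnn leq_add// leq_divM.
pose Ls := [seq (l, x) | l <- P, x <- X].
have uLs : uniq Ls by apply: allpairs_uniq => // -[? ?] [? ?].
have Ls0 : {in Ls, forall z, z.1 != 0}.
  by move=> z /allpairsP[[l x] [/P0 l0 _ ->]].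
have := @grid_incidences R A m s uA isT nsm Ls uLs Ls0.
rewrite size_allpairs -/n -/p => H.
(* Each [x] in [X] has at least [t] elements [a] of [C'] with [a - x] in [A], and each such [a]
   equals [l * c] with [c] in [C] for at least [q] ratios [l]. Every pair [(a, l)] puts the grid
   point [(c, a - x)] on the line of [(l, x)]. *)
have I : (size X * (t * q) <= \sum_(z <- Ls) count (fun a => (z.1 * a - z.2)%R \in A) A)%N.
  rewrite big_allpairs_dep exchange_big /=; apply: geq_sum_seq_const => x xX.
  apply: (@leq_trans (\sum_(a <- C') ((a - x)%R \in A) * q)%N).
    have -> : (\sum_(a <- C') ((a - x)%R \in A) * q = diff_rep C' x * q)%N.
      by rewrite -big_distrl /= /diff_rep -sum1_count [in RHS]big_mkcond.
    by rewrite leq_mul2r tX ?orbT.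
  apply: (@leq_trans (\sum_(a <- C') count (fun l => ((a - x)%R \in A) && ((a / l)%R \in C)) P)%N).
    rewrite !big_seq; apply: leq_sum => a aC'.
    by case: (_ \in A); rewrite ?mul0n // mul1n qC.
  rewrite -sum_count_exchange !big_seq; apply: leq_sum => l lP.
  rewrite -!size_filter -(size_map (fun a => a / l)).
  apply: uniq_leq_size => [|b /mapP[a]].
    by rewrite map_inj_uniq ?filter_uniq//; apply: mulIf; rewrite invr_neq0// P0.
  rewrite !mem_filter => /andP[/andP[ax al] aC'] ->.
  by rewrite (CA _ al) mulrC divfK ?P0// ax.
have {I H} := leq_trans I H.
have := leq_divM (t * q) (4 * p); have := ltn_ceil (t * q) (isT : 0 < 4)%N.
have : (t * q < s.+1 * (4 * p))%N by rewrite ltn_ceil// muln_gt0.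
rewrite -/s; move: (t * q)%N (size X) => T x lt _ le H.
have {}H : (x * T <= 2 * (n * m) ^ 2)%N by nia.
have {}lt : (T <= 8 * p * s)%N by nia.
apply: (@leq_trans (x * T * (8 * p * s) ^ 2)%N).
  by rewrite (expnS _ 2) mulnA leq_mul2l leq_exp2r// lt orbT.
apply: (@leq_trans (2 * (n * m) ^ 2 * (8 * p * s) ^ 2)%N); first by rewrite leq_mul2r H orbT.
rewrite [leqLHS](_ : _ = 128 * n ^ 2 * p ^ 2 * (m * s) ^ 2)%N; last by ring.
apply: (@leq_trans (128 * n ^ 2 * p ^ 2 * (2 * n) ^ 2)%N).
  by rewrite leq_mul2l leq_exp2r// msn orbT.
by rewrite [leqLHS](_ : _ = 512 * n ^ 4 * p ^ 2)%N//; ring.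
Qed.

(** Three dyadic pigeonholings select in turn the popular ratios [P], the elements [C'] of [C] that
    take part in many of them, and the popular differences [X] of [C'] and [A]. Each costs a factor
    [L], the number of available scales. *)
Lemma structured_subset (L : nat) (C Lam D : seq R) :
  (size A < 2 ^ L)%N ->
  {subset C <= A} -> uniq C -> 0 \notin C -> uniq Lam -> {in Lam, forall l, l != 0} ->
  uniq D -> (0 < \sum_(l <- Lam) ratio_rep C l ^ 3)%N ->
  exists C' : seq R, [/\ uniq C', {subset C' <= C}, (0 < size C')%N &
   ((\sum_(x <- D) diff_rep C' x ^ 3) * (\sum_(l <- Lam) ratio_rep C l ^ 3) <=
    2 ^ 18 * L ^ 5 * size A ^ 4 * size C' ^ 3)%N].
Proof.
move=> AL CA uC C0 uLam Lam0 uD; set E := (\sum_(l <- Lam) _)%N => E0.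
set n := size A.
have Cn : (size C <= n)%N by apply: uniq_leq_size.
have n0 : (0 < n)%N.
  rewrite lt0n; apply: contraTN E0 => /eqP n0; rewrite -leqNgt leqn0 /E.
  have -> : C = [::] by apply/eqP; rewrite -size_eq0 -leqn0 -n0.
  by rewrite big1// => l _; rewrite exp0n.
have L0 : (0 < L)%N by case: (L) AL => //; rewrite expn0 ltnS leqn0 -/n; lia.
have lt2L k : (k <= n)%N -> (k < 2 ^ L)%N by move=> kn; exact: leq_ltn_trans kn AL.
have rle l : (ratio_rep C l <= n)%N by apply: leq_trans (count_size _ _) Cn.
(* As 0 is not in [C], distinct ratios [l] give distinct quotients [a / l]. *)
have dgle a P : uniq P -> a \in C -> {in P, forall l, l != 0} ->
    (count (fun l => (a / l)%R \in C) P <= n)%N.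
  move=> uP aC P0; apply: leq_trans Cn; apply: count_mem_inj => // l l' lP lP' /=.
  by move/(mulfI (_ : a != 0)) => H; apply: invr_inj; apply: H; apply: contraNneq C0 => <-.
have [j1 hE] := @dyadic_pigeonhole _ Lam (ratio_rep C) 3 L isT L0 (fun l _ => lt2L _ (rle l)).
rewrite -/E -size_filter in hE; move: hE.
set tau := (2 ^ j1)%N; set P := seq.filter _ Lam => hE.
have uP : uniq P by rewrite filter_uniq.
have P0 : {in P, forall l, l != 0} by move=> l; rewrite mem_filter => /andP[_ /Lam0].
have p0 : (0 < size P)%N by rewrite lt0n; apply: contraTN E0 => /eqP p0; move: hE; rewrite p0; lia.
pose deg a := count (fun l => (a / l)%R \in C) P.
(* Double counting of the pairs [(l, a)] with [l] in [P] and both [a] and [a / l] in [C]. *)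
have tp : (tau * size P <= \sum_(a <- C) deg a)%N.
  rewrite mulnC /deg -sum_count_exchange; apply: geq_sum_seq_const => l.
  by rewrite mem_filter => /andP[].
have degn : {in C, forall a, (deg a < 2 ^ L)%N} by move=> a aC; apply: lt2L; exact: dgle.
have [j2] := @dyadic_pigeonhole _ C deg 1 L isT L0 degn.
under eq_bigr do rewrite expn1.
rewrite !expn1 -size_filter; set q := (2 ^ j2)%N; set C' := seq.filter _ C => hq.
have q0 : (0 < q)%N by rewrite expn_gt0.
have C'C : {subset C' <= C} by move=> a; rewrite mem_filter => /andP[].
have uC' : uniq C' by rewrite filter_uniq.
have tpq := leq_trans tp hq.
have tau0 : (0 < tau)%N by rewrite expn_gt0.
have c0 : (0 < size C')%N.
  by rewrite lt0n; apply: contraTN tpq => /eqP ->; rewrite !muln0 -ltnNge muln_gt0 tau0.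
exists C'; split => //.
have dn x : (diff_rep C' x <= n)%N.
  apply: leq_trans (count_size _ _) _; apply: leq_trans Cn; exact: uniq_leq_size.
have [j3] := @dyadic_pigeonhole _ D (diff_rep C') 3 L isT L0 (fun x _ => lt2L _ (dn x)).
rewrite -size_filter; set t := (2 ^ j3)%N; set X := seq.filter _ D => hF.
have uX : uniq X by rewrite filter_uniq.
have tX : {in X, forall x, (t <= diff_rep C' x)%N} by move=> x; rewrite mem_filter => /andP[].
have qC : {in C', forall a, (q <= deg a)%N} by move=> a; rewrite mem_filter => /andP[].
(* The first case is exactly what makes the number of cells per axis positive in [rich_lines]; in
   the second, trivial counts are enough. *)
have [tq|tq] := leqP (4 * size P) (t * q).
  apply: rich_lines_arith q0 hE tpq hF _.
  case: (posnP (size X)) => [->|]; first by rewrite mul0n.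
  rewrite -has_predT => /hasP[x xX _].
  apply: (rich_lines CA uC uC' C'C uP uX P0 qC tX tq p0).
  apply: leq_mul; first exact: leq_trans (tX _ xX) (dn x).
  move: c0; rewrite -has_predT => /hasP[a aC' _].
  exact: leq_trans (qC _ aC') (count_size _ _).
apply: poor_lines_arith q0 L0 n0 hE tpq hF (ltnW tq) _ _.
  apply: (@leq_trans (\sum_(x <- X) diff_rep C' x)%N); first exact: geq_sum_seq_const.
  rewrite /diff_rep sum_count_exchange; apply: leq_sum_seq_const => a _.
  by apply: count_mem_inj => // x y _ _ /addrI/oppr_inj.
apply: leq_trans tp _; rewrite -mulnn.
apply: (@leq_trans (size C * n)%N); last by rewrite leq_mul2r Cn orbT.
by apply: leq_sum_seq_const => a aC; exact: dgle.
Qed.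
End KeyProposition.

(** * Convexity and the extremal partition *)

(** With denominators cleared, this is [(u + v)^3 / (a + b)^2 <= u^3 / b^2 + v^3 / a^2], Jensen's
    inequality for the cube. Equality at [u * a = v * b] explains the square factor in the
    difference. *)
Lemma weighted_cube_convexity (a b u v : nat) :
  (a ^ 2 * b ^ 2 * (u + v) ^ 3 <=
   (a + b) ^ 2 * (a ^ 2 * u ^ 3 + b ^ 2 * v ^ 3))%N.
Proof.
rewrite -(ler_nat int) -subr_ge0 !(natrM, natrD, natrX).
set a' : int := a%:R; set b' : int := b%:R; set u' : int := u%:R; set v' : int := v%:R.
rewrite (_ : _ - _ = (u' * a' - v' * b') ^+ 2 *
  ((a' + 2 * b') * u' * a' + (b' + 2 * a') * v' * b')); last by ring.
by rewrite mulr_ge0 ?sqr_ge0// addr_ge0// !mulr_ge0// addr_ge0// mulr_ge0.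
Qed.

Lemma weighted_square_convexity (a b u v : nat) :
  (a * b * (u + v) ^ 2 <= (a + b) * (a * u ^ 2 + b * v ^ 2))%N.
Proof.
rewrite -(ler_nat int) -subr_ge0 !(natrM, natrD, natrX).
set a' : int := a%:R; set b' : int := b%:R; set u' : int := u%:R; set v' : int := v%:R.
by rewrite (_ : _ - _ = (u' * a' - v' * b') ^+ 2) ?sqr_ge0//; ring.
Qed.

Lemma sum_sqr_ge (T : eqType) (s : seq T) (f : T -> nat) :
  ((\sum_(x <- s) f x) ^ 2 <= size s * \sum_(x <- s) f x ^ 2)%N.
Proof.
elim: s => [|x s IH]; first by rewrite !big_nil.
rewrite !big_cons /=; set S := (\sum_(i <- s) f i)%N in IH *.
set S2 := (\sum_(i <- s) _)%N in IH *.
have [s0|N0] := posnP (size s).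
  by rewrite /S /S2 (size0nil s0) !big_nil !addn0 mul1n.
rewrite -(leq_pmul2l N0).
have := weighted_square_convexity (size s) 1 (f x) S.
rewrite muln1 => H; apply: leq_trans H _.
rewrite addn1 mul1n mulnCA leq_mul2l mulnDr; apply/orP; right.
by rewrite leq_add2l.
Qed.

Lemma sum_cube_ge (T : eqType) (s : seq T) (f : T -> nat) :
  ((\sum_(x <- s) f x) ^ 3 <= size s ^ 2 * \sum_(x <- s) f x ^ 3)%N.
Proof.
elim: s => [|x s IH]; first by rewrite !big_nil.
rewrite !big_cons /=; set S := (\sum_(i <- s) f i)%N in IH *.
set S2 := (\sum_(i <- s) _)%N in IH *.
have [s0|N0] := posnP (size s).
  by rewrite /S /S2 (size0nil s0) !big_nil !addn0 exp1n mul1n.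
have N20 : (0 < size s ^ 2)%N by rewrite expn_gt0 N0.
rewrite -(leq_pmul2l N20).
have := weighted_cube_convexity (size s) 1 (f x) S.
rewrite exp1n muln1 => H; apply: leq_trans H _.
rewrite addn1 mul1n mulnCA leq_mul2l mulnDr; apply/orP; right.
by rewrite leq_add2l.
Qed.

Section Partition.
Variables (R : realFieldType) (A D : seq R).

Definition diff_energy (B : seq R) := (\sum_(x <- D) diff_rep A B x ^ 3)%N.

Lemma diff_energy_cat (B C : seq R) :
  (size B ^ 2 * size C ^ 2 * diff_energy (B ++ C) <=
   (size B + size C) ^ 2 *
     (size C ^ 2 * diff_energy B + size B ^ 2 * diff_energy C))%N.
Proof.
rewrite /diff_energy 3!big_distrr /= -big_split big_distrr /=.
apply: leq_sum => x _; rewrite /diff_rep count_cat.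
rewrite (mulnC (size B ^ 2)%N) (addnC (size B)).
exact: weighted_cube_convexity.
Qed.

(** By [diff_energy_cat], the quotient of [diff_energy] by the squared size is subadditive under
    concatenation, and a bound linear in the size passes to sums. This is why the condition carries
    the exponent 3. *)
Lemma diff_energy_cat_le (M : R) (B C : seq R) :
  (0 < size B)%N -> (0 < size C)%N ->
  (diff_energy B)%:R <= M * (size B)%:R ^+ 3 ->
  (diff_energy C)%:R <= M * (size C)%:R ^+ 3 ->
  (diff_energy (B ++ C))%:R <= M * (size (B ++ C))%:R ^+ 3.
Proof.
move=> B0 C0 hB hC; have := diff_energy_cat B C.
rewrite -(ler_nat R) size_cat !(natrM, natrD, natrX).
set b : R := (size B)%:R in hB *; set c : R := (size C)%:R in hC * => H.
have b0 : 0 < b by rewrite ltr0n.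
have c0 : 0 < c by rewrite ltr0n.
rewrite -(ler_pM2l (_ : 0 < b ^+ 2 * c ^+ 2)); last by rewrite mulr_gt0// exprn_gt0.
apply: (le_trans H).
apply: (@le_trans _ _ ((b + c) ^+ 2 * (c ^+ 2 * (M * b ^+ 3) + b ^+ 2 * (M * c ^+ 3)))).
  by rewrite ler_wpM2l ?sqr_ge0// lerD// ler_wpM2l ?sqr_ge0.
by rewrite le_eqVlt; apply/orP; left; apply/eqP; ring.
Qed.

(* B is a maximal subset of A \ {0} with diff_energy B <= M |B|^3; by
   diff_energy_cat_le the rest of A \ {0} contains no such nonempty set. *)
Lemma energy_partition (L : nat) (M N : R) :
  uniq A -> (size A < 2 ^ L)%N -> uniq D -> 0 < N ->
  (2 ^ 18 * L ^ 5 * size A ^ 4)%:R <= N * M ->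
  exists B : seq R, [/\ uniq B, {subset B <= A}, 0 \notin B,
    (diff_energy B)%:R <= M * (size B)%:R ^+ 3 &
    forall Lam : seq R, uniq Lam -> {in Lam, forall l, l != 0} ->
      (\sum_(l <- Lam)
        ratio_rep [seq x <- A | (x != 0)%R && (x \notin B)] l ^ 3)%:R <= N].
Proof.
move=> uA AL uD N0 MN.
pose good (B : seq R) := [/\ uniq B, {subset B <= A}, 0 \notin B &
    (diff_energy B)%:R <= M * (size B)%:R ^+ 3].
pose P k := `[< exists2 B, good B & size B = k >].
have exP : exists k, P k.
  exists 0; apply/asboolP; exists [::] => //; split => //=.
  rewrite expr0n mulr0 /diff_energy big1// => x _; exact: exp0n.
have bP k : P k -> (k <= size A)%N.
  by move=> /asboolP[B [uB BA _ _] <-]; exact: uniq_leq_size.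
case: (ex_maxnP exP bP) => k /asboolP[B [uB BA B0 hB] <-{k}] maxB.
exists B; split => // Lam uLam Lam0; rewrite leNgt; apply/negP => EN.
set C := [seq x <- A | _] in EN.
have CA : {subset C <= A} by move=> x; rewrite mem_filter => /andP[].
have uC : uniq C by rewrite filter_uniq.
have C0 : 0 \notin C by rewrite mem_filter eqxx.
set E := (\sum_(l <- Lam) _)%N in EN.
have E0 : (0 < E)%N by rewrite -(ltr0n R); exact: lt_trans EN.
have [C' [uC' C'C c0]] := structured_subset uA AL CA uC C0 uLam Lam0 uD E0.
rewrite -/E -/(diff_energy _) -(ler_nat R) natrM (natrM _ (_ * _)%N) => H.
(* Since [E > N] and the numerator is at most [N * M], the set [C'] satisfies the same condition as
   [B]; then so does [B ++ C'], against maximality. *)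
have hC' : (diff_energy C')%:R <= M * (size C')%:R ^+ 3.
  have E0' : 0 < E%:R :> R by rewrite ltr0n.
  have M0 : 0 <= M.
    rewrite -(pmulr_rge0 _ N0); exact: le_trans MN.
  rewrite -(ler_pM2r E0'); apply: (le_trans H).
  rewrite natrX mulrAC ler_wpM2r ?exprn_ge0//.
  by apply: (le_trans MN); rewrite mulrC ler_wpM2l// ltW.
have disj : uniq (B ++ C').
  rewrite cat_uniq uB uC' andbT /=; apply/hasPn => x /C'C.
  by rewrite mem_filter => /andP[/andP[]].
have : P (size (B ++ C')).
  apply/asboolP; exists (B ++ C') => //; split => //.
  - by move=> x; rewrite mem_cat => /orP[/BA//|/C'C/CA].
  - by rewrite mem_cat negb_or B0; apply: contra C0; exact: C'C.
  - case: (posnP (size B)) => [/size0nil ->//|b0].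
    exact: diff_energy_cat_le.
by move/maxB; rewrite size_cat -[leqRHS]addn0 leq_add2l leqNgt c0.
Qed.

End Partition.

(** * The energies as counts of triples and as sums of cubes *)

Lemma card_fset_filter (K : choiceType) (F : {fset K}) (P : pred K) :
  #|` [fset x in F | P x]%fset| = count P F.
Proof.
rewrite -size_filter; apply: perm_size; apply: uniq_perm => [||x].
- exact: fset_uniq.
- by rewrite filter_uniq ?fset_uniq.
- by rewrite mem_filter !inE andbC.
Qed.

Lemma perm_fset_prod (K1 K2 : choiceType) (F : {fset K1}) (G : {fset K2}) :
  perm_eq (F `*` G)%fset [seq (x, y) | x <- F, y <- G].
Proof.
apply: uniq_perm => [||[x y]].
- exact: fset_uniq.
- by apply: allpairs_uniq; rewrite ?fset_uniq// => -[? ?] [? ?].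
- rewrite in_fsetM; apply/andP/allpairsP => [[xF yG]|[[a b] [aF bG [-> ->]]]//].
  by exists (x, y).
Qed.

Lemma sum_fibers (S V : eqType) (s : seq S) (vs : seq V) (h : S -> V)
    (F : V -> nat) :
  uniq vs -> {in s, forall x, h x \in vs} ->
  (\sum_(x <- s) F (h x) = \sum_(v <- vs) count (fun x => h x == v) s * F v)%N.
Proof.
move=> uvs hvs.
transitivity (\sum_(x <- s) \sum_(v <- vs) if h x == v then F v else 0)%N.
  rewrite !big_seq; apply: eq_bigr => x xs.
  rewrite (bigD1_seq (h x)) ?hvs//= eqxx big1 ?addn0// => v.
  by rewrite eq_sym => /negbTE ->.
rewrite exchange_big; apply: eq_bigr => v _.
rewrite -big_mkcond /= -sum1_count big_distrl /=.
by apply: eq_bigr => x _; rewrite mul1n.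
Qed.

Lemma sum_count_fibers (S V : eqType) (s : seq S) (vs : seq V) (h : S -> V) :
  uniq vs -> {in s, forall x, h x \in vs} ->
  (\sum_(v <- vs) count (fun x => h x == v) s = size s)%N.
Proof.
move=> uvs hvs; rewrite -sum1_size (sum_fibers (fun=> 1%N) uvs hvs).
by apply: eq_bigr => v _; rewrite muln1.
Qed.

Lemma count_allpairs (S T U : Type) (f : S -> T -> U) (s : seq S) (t : seq T)
    (P : pred U) :
  count P [seq f x y | x <- s, y <- t] =
  (\sum_(x <- s) count (fun y => P (f x y)) t)%N.
Proof.
elim: s => [|x s IH]; first by rewrite big_nil.
by rewrite big_cons /= count_cat count_map IH.
Qed.

(** The third energy of an arbitrary map [h]. Counting triples avoids naming the set of values, so
    energies of different maps can be compared directly. *)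
Definition equal_triples (S V : eqType) (h : S -> V) (s : seq S) : nat :=
  (\sum_(p <- s) \sum_(q <- s) count (fun r => (h p == h q) && (h q == h r)) s)%N.

Lemma equal_triplesE (S V : eqType) (h : S -> V) (s : seq S) (vs : seq V) :
  uniq vs -> {in s, forall x, h x \in vs} ->
  equal_triples h s = (\sum_(v <- vs) count (fun x => h x == v) s ^ 3)%N.
Proof.
move=> uvs hvs; rewrite /equal_triples exchange_big /=.
transitivity (\sum_(q <- s) count (fun x => h x == h q) s ^ 2)%N.
  apply: eq_bigr => q _.
  transitivity (\sum_(p <- s) (h p == h q) * count (fun r => h r == h q) s)%N.
    apply: eq_bigr => p _; case: eqP => _ /=; last by rewrite count_pred0.
    by rewrite mul1n; apply: eq_count => r; exact: eq_sym.
  rewrite -big_distrl /= -mulnn; congr (_ * _)%N.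
  by rewrite -sum1_count [RHS]big_mkcond.
rewrite (sum_fibers (fun v => count (fun x => h x == v) s ^ 2)%N uvs hvs).
by apply: eq_bigr => v _; rewrite -expnS.
Qed.

(** Hölder's inequality for the fibre sizes of [h]: few values force many coincidences. *)
Lemma equal_triples_ge (S V : eqType) (h : S -> V) (s : seq S) (vs : seq V) :
  uniq vs -> {in s, forall x, h x \in vs} ->
  (size s ^ 3 <= size vs ^ 2 * equal_triples h s)%N.
Proof.
move=> uvs hvs; rewrite (equal_triplesE uvs hvs) -(sum_count_fibers uvs hvs).
exact: sum_cube_ge.
Qed.

Lemma equal_triples_sub (S V W : eqType) (h : S -> V) (g : S -> W) (s t : seq S) :
  uniq s -> uniq t -> {subset s <= t} -> {in s &, forall x y, h x = h y -> g x = g y} ->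
  (equal_triples h s <= equal_triples g t)%N.
Proof.
move=> us ut st hg.
have mono (f : S -> nat) : (\sum_(x <- s) f x <= \sum_(x <- t) f x)%N.
  rewrite [leqRHS](bigID (mem s)) /= -[in leqRHS]big_filter.
  apply: leq_trans (leq_addr _ _); rewrite leq_eqVlt; apply/orP; left; apply/eqP.
  apply: perm_big; apply: uniq_perm => // [|x]; first exact: filter_uniq.
  by rewrite mem_filter; case: (boolP (x \in s)) => [/st ->|].
apply: leq_trans (mono _); rewrite /equal_triples !big_seq; apply: leq_sum => p ps.
apply: leq_trans (mono _); rewrite !big_seq; apply: leq_sum => q qs.
rewrite -!sum1_count big_mkcond [leqRHS]big_mkcond /=.
apply: leq_trans (mono _); rewrite !big_seq; apply: leq_sum => r rs.
case: ifP => // /andP[/eqP /(hg _ _ ps qs) -> /eqP /(hg _ _ qs rs) ->].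
by rewrite !eqxx.
Qed.

Section Energies.
Variable R : realType.
Implicit Type X : {fset R}.

Lemma diff_repE (A B : seq R) (x : R) : uniq A ->
  diff_rep A B x = count (fun p => p.1 - p.2 == x) [seq (a, b) | a <- B, b <- A].
Proof.
move=> uA; rewrite count_allpairs /diff_rep -sum1_count [LHS]big_mkcond.
apply: eq_bigr => a _ /=; rewrite (eq_count (a2 := pred1 (a - x))).
  by rewrite count_uniq_mem//; case: (_ \in _).
by move=> b /=; rewrite subr_eq [RHS]eq_sym subr_eq addrC.
Qed.

Lemma mult_repE X (l : R) : l != 0 -> mult_rep X l = ratio_rep X l.
Proof.
move=> l0; rewrite /mult_rep card_fset_filter (seq.permP (perm_fset_prod _ _)).
rewrite count_allpairs /ratio_rep -sum1_count [RHS]big_mkcond.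
apply: eq_bigr => a _ /=; rewrite (eq_count (a2 := pred1 (a / l))).
  by rewrite count_uniq_mem ?fset_uniq//; case: (_ \in _).
by move=> b /=; apply/eqP/eqP => ->; rewrite mulrC ?mulKf ?divfK.
Qed.

Lemma energy3_addE X :
  energy3_add X =
  equal_triples (fun p : R * R => p.1 - p.2) [seq (a, b) | a <- X, b <- X].
Proof.
rewrite /energy3_add card_fset_filter (seq.permP (perm_fset_prod _ _)).
rewrite count_allpairs /equal_triples.
have pX := perm_fset_prod X X.
rewrite (perm_big _ (perm_fset_prod _ _)) big_allpairs /=.
rewrite (perm_big _ pX); apply: eq_bigr => p _.
rewrite (perm_big _ pX); apply: eq_bigr => q _.
by rewrite (seq.permP pX).
Qed.

Lemma energy3_mul_ge X (Lam : seq R) :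
  uniq Lam -> {in Lam, forall l, l != 0} ->
  (((\sum_(l <- Lam) mult_rep X l ^ 3)%N%:R)%:E <= energy3_mul X)%E.
Proof.
move=> uL L0; apply: esum_ge; exists [set` Lam]%classic.
  by split; [exact: finite_seq | move=> l /= /L0].
by rewrite -fsbig_seq//= sumEFin natr_sum.
Qed.

Lemma energy3_mul_le X (N : R) :
  (forall Lam : seq R, uniq Lam -> {in Lam, forall l, l != 0} ->
    (\sum_(l <- Lam) ratio_rep X l ^ 3)%:R <= N) ->
  (energy3_mul X <= N%:E)%E.
Proof.
move=> H; apply: ge_ereal_sup => _ [S [finS S0] <-].
have S0' : {in fset_set S, forall l, l != 0}.
  by move=> l; rewrite in_fset_set// inE => /S0.
rewrite fsbig_finite//= sumEFin lee_fin; apply: le_trans (H _ (fset_uniq _) S0').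
rewrite natr_sum le_eqVlt; apply/orP; left; apply/eqP.
by rewrite !big_seq; apply: eq_bigr => l /S0' l0; rewrite mult_repE.
Qed.

(** Allowing 0 in [X] raises each representation count by at most one, and
    [(v + 1)^3 <= 4 * v^3 + 4]. *)
Lemma energy3_add_le X (A B D : seq R) :
  uniq A -> {subset X <= A} -> {subset X <= 0 :: B} -> uniq D ->
  {in A &, forall a b, a - b \in D} ->
  (energy3_add X <= 4 * diff_energy A D B + 4 * size D)%N.
Proof.
move=> uA XA XB uD AD.
rewrite energy3_addE (equal_triplesE uD); last first.
  by move=> _ /allpairsP[[a b] [/XA aA /XA bA ->]] /=; exact: AD.
rewrite /diff_energy -mulnDr -[size D]sum1_size -big_split big_distrr /=.
apply: leq_sum => x _; rewrite -diff_repE ?fset_uniq//.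
have : (diff_rep X X x <= diff_rep A B x + 1)%N.
  rewrite /diff_rep.
  apply: (@leq_trans (count (fun a => a - x \in A) X)).
    by apply: sub_count => a /= /XA.
  rewrite -[1%N]/(count xpredT [:: 0 : R]) -!size_filter -size_cat.
  apply: uniq_leq_size; first by rewrite filter_uniq ?fset_uniq.
  move=> a; rewrite mem_filter => /andP[ax /XB]; rewrite mem_cat !inE.
  by case/orP => [->|aB]; rewrite ?orbT// mem_filter ax aB.
move: (diff_rep X X x) (diff_rep A B x) => u v uv.
apply: (@leq_trans ((v + 1) ^ 3)%N); first by rewrite leq_exp2r.
have := weighted_cube_convexity 1 1 v 1; rewrite !exp1n !mul1n; lia.
Qed.
End Energies.

(** * The decomposition with exponent 2/5 *)

Lemma trunc_log2_le (R : realType) (n : nat) : (2 <= n)%N ->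
  1 <= log2 n%:R :> R /\ (trunc_log 2 n).+1%:R <= 2 * log2 n%:R :> R.
Proof.
move=> n2; have ln2 : 0 < ln 2 :> R by rewrite ln_gt0// ltr1n.
have n0 : (0 < n%:R :> R) by rewrite ltr0n ltnW.
have le2 (k : nat) : (2 ^ k <= n)%N -> k%:R <= log2 n%:R :> R.
  move=> kn; rewrite /log2 ler_pdivlMr// mulr_natl -lnXn// ler_ln ?posrE// ?exprn_gt0//.
  by rewrite -natrX ler_nat.
have := le2 1%N n2; have := le2 (trunc_log 2 n) (trunc_logP (ltnSn 1) (ltnW n2)).
by rewrite -natr1; lra.
Qed.

Lemma decomposition_exists (R : realType) (A : {fset R}) : (2 <= #|` A|)%N ->
  exists B C : {fset R},
    [/\ (B `|` C)%fset = A, [disjoint B & C]%fset &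
      (Order.max (energy3_add B)%:R%:E (energy3_mul C) <=
       (2 ^+ 26 * (#|` A|%:R `^ (4 - 2 / 5)) * (log2 (#|` A|%:R : R)) `^ 5)%:E)%E].
Proof.
move=> n2; set n := #|` A| in n2 *.
have n0 : 0 < n%:R :> R by rewrite ltr0n ltnW.
have n1 : 1 <= n%:R :> R by rewrite ler1n ltnW.
have nn0 : n%:R != 0 :> R by rewrite gt_eqF.
have [lg1 Llg] := trunc_log2_le R n2.
set lg : R := log2 _ in lg1 Llg *; set L := (trunc_log 2 n).+1 in Llg.
have nL : (size A < 2 ^ L)%N by apply: trunc_log_ltn.
(* [N] is the target for the multiplicative energy, and [M] is the matching factor with
   [N * M = 2^18 * L^5 * n^4]. Then [M * n^3] is [n^(17/5)] up to logarithms, which lies below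
   [N]. *)
pose N : R := n%:R `^ (4 - 2 / 5).
pose M : R := 2 ^+ 18 * L%:R ^+ 5 * n%:R `^ (2 / 5).
pose D := undup [seq (a - b)%R | a <- A, b <- A].
have uD : uniq D by exact: undup_uniq.
have N0 : 0 < N by exact: powR_gt0.
have MN : (2 ^ 18 * L ^ 5 * size A ^ 4)%:R <= N * M.
  rewrite /M mulrCA /N -powRD ?subrK; last by rewrite nn0 implybT.
  by rewrite (powR_mulrn 4 (ltW n0)) natrM (natrM _ (2 ^ 18)%N) !natrX.
have [B [uB BA B0 hB hC]] := energy_partition (fset_uniq A) nL uD N0 MN.
(* The element 0 must go to the additive part, because it would make [energy3_mul] infinite. *)
pose X := [fset x in A | (x == 0) || (x \in B)]%fset.
pose Y := [fset x in A | (x != 0) && (x \notin B)]%fset.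
exists X, Y; split.
- by apply/fsetP => x; rewrite !inE -negb_or -andb_orr orbN andbT.
- apply/fdisjointP => x; rewrite !inE => /andP[-> H].
  by rewrite -negb_or H.
rewrite ge_max; apply/andP; split; last first.
  apply: (@le_trans _ _ N%:E).
    apply: energy3_mul_le => Lam uL L0; apply: le_trans (hC _ uL L0).
    rewrite ler_nat; apply: leq_sum => l _; rewrite leq_exp2r// /ratio_rep.
    set C := [seq _ <- _ | _].
    have YC : perm_eq Y C.
      apply: uniq_perm; rewrite ?filter_uniq ?fset_uniq// => x.
      by rewrite mem_filter !inE andbC.
    rewrite (seq.permP YC); apply: sub_count => a /=.
    by rewrite (perm_mem YC).
  rewrite lee_fin -/N mulrAC ler_peMl ?(ltW N0)//.
  rewrite -[leLHS]mulr1 ler_pM//; first by rewrite exprn_ege1// ler1n.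
  by rewrite (powR_mulrn 5) ?(le_trans ler01)// exprn_ege1.
rewrite lee_fin.
have D2 : (size D <= n ^ 2)%N.
  by apply: leq_trans (size_undup _) _; rewrite size_allpairs mulnn.
have Bn : (size B <= n)%N by exact: uniq_leq_size.
have : (energy3_add X <= 4 * diff_energy A D B + 4 * size D)%N.
  apply: energy3_add_le => //.
  - exact: fset_uniq.
  - by move=> x; rewrite !inE => /andP[].
  - by move=> x; rewrite !inE => /andP[].
  - by move=> a b aA bA; rewrite mem_undup; apply/allpairsP; exists (a, b).
rewrite -(ler_nat R) natrD !natrM => H; apply: (le_trans H).
have NE : N = n%:R `^ (1 / 5) * (n%:R `^ (2 / 5) * n%:R ^+ 3).
  rewrite -(powR_mulrn 3 (ltW n0)) -!powRD ?nn0 ?implybT//; congr (_ `^ _).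
  by field.
have r1 : 1 <= n%:R `^ (1 / 5) :> R.
  by rewrite -[leLHS](powRr0 n%:R) ler_powR//; lra.
have s1 : 1 <= n%:R `^ (2 / 5) :> R.
  by rewrite -[leLHS](powRr0 n%:R) ler_powR//; lra.
(* The bound [L <= 2 * lg] turns [2^18 * L^5] into [2^23 * lg^5]; four times this plus the
   contribution of [D] stays below [2^26 * lg^5 * N]. *)
have hB' : (diff_energy A D B)%:R <= 2 ^+ 23 * lg ^+ 5 * N.
  apply: (le_trans hB).
  apply: (@le_trans _ _ (2 ^+ 18 * (2 * lg) ^+ 5 * n%:R `^ (2 / 5) * n%:R ^+ 3)).
    rewrite /M ler_pM ?exprn_ge0 ?mulr_ge0 ?powR_ge0 ?exprn_ge0//.
      rewrite ler_wpM2r ?powR_ge0// ler_wpM2l ?exprn_ge0// lerXn2r// nnegrE//.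
      by rewrite mulr_ge0// (le_trans ler01).
    by rewrite lerXn2r ?nnegrE// ler_nat.
  pose P : R := n%:R `^ (2 / 5) * n%:R ^+ 3.
  have P0 : 0 <= P by rewrite mulr_ge0 ?powR_ge0// exprn_ge0.
  rewrite [leLHS](_ : _ = 2 ^+ 23 * lg ^+ 5 * P); last by rewrite /P; ring.
  rewrite NE -/P ler_wpM2l ?ler_peMl//.
  by rewrite mulr_ge0 ?exprn_ge0 ?(le_trans ler01 lg1).
have hD : (size D)%:R <= lg ^+ 5 * N.
  apply: (@le_trans _ _ (n%:R ^+ 3)).
    by rewrite -natrX ler_nat; apply: leq_trans D2 _; rewrite leq_pexp2l// ltnW.
  rewrite -[leLHS]mul1r NE ler_pM ?exprn_ege1// ?exprn_ge0//.
  by rewrite mulrA ler_peMl ?exprn_ge0//; nra.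
rewrite -/N (powR_mulrn 5) ?(le_trans ler01)//.
have : 0 <= lg ^+ 5 * N by apply: le_trans hD.
lra.
Qed.

(** * The lower bound from dyadic dilates of odd numbers *)

Lemma equal_pairs_ge (S V : eqType) (h : S -> V) (s : seq S) (vs : seq V) :
  uniq vs -> {in s, forall x, h x \in vs} ->
  (size s ^ 2 <=
   size vs * size [seq p <- [seq (x, y) | x <- s, y <- s] | h p.1 == h p.2])%N.
Proof.
move=> uvs hvs; rewrite -{1}(sum_count_fibers uvs hvs).
apply: leq_trans (sum_sqr_ge _ _) _; rewrite leq_mul2l; apply/orP; right.
rewrite size_filter count_allpairs /=.
under [leqRHS]eq_bigr do under eq_count do rewrite eq_sym.
rewrite (sum_fibers (fun v => count (fun x => h x == v) s) uvs hvs).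
by apply: leq_sum => v _; rewrite mulnn.
Qed.

Lemma equal_triples_map (S T V : eqType) (h : T -> V) (f : S -> T) (s : seq S) :
  equal_triples h (map f s) = equal_triples (h \o f) s.
Proof.
rewrite /equal_triples big_map; apply: eq_bigr => p _.
by rewrite big_map; apply: eq_bigr => q _; rewrite count_map.
Qed.

Section DyadicDilates.
Variables (R : realType) (J Q : nat).

Definition dyadic (p : nat * nat) : R := ((2 * p.1 + 1) * 2 ^ p.2)%N%:R.

Lemma dyadicE i k : dyadic (i, k) = (2 * i%:R + 1) * 2 ^+ k.
Proof. by rewrite /dyadic natrM natrX natrD (natrM _ 2%N). Qed.

(** The 2-adic valuation recovers the exponent, since [2 * i + 1] is odd. *)
Lemma dyadic_inj : injective dyadic.
Proof.
move=> [i k] [j l] /eqP; rewrite eqr_nat => /eqP /= e.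
have odd_log a b : logn 2 ((2 * a + 1) * 2 ^ b) = b.
  by rewrite lognM ?expn_gt0 ?addn1// pfactorK// lognE /= dvdn2 /= mul2n odd_double.
have kl : k = l by rewrite -(odd_log i k) e odd_log.
move: e; rewrite kl => /eqP; rewrite eqn_pmul2r ?expn_gt0// => /eqP e.
by congr (_, _); lia.
Qed.

Definition box := [seq (i, k) | i <- iota 0 Q, k <- iota 0 J].

Lemma box_uniq : uniq box.
Proof. by apply: allpairs_uniq; rewrite ?iota_uniq// => -[? ?] [? ?]. Qed.

Lemma mem_box p : (p \in box) = (p.1 < Q)%N && (p.2 < J)%N.
Proof.
apply/allpairsP/andP => [[[i k] /= [+ + ->]]|[pQ pJ]].
  by rewrite !mem_iota.
by exists p; rewrite !mem_iota; case: p pQ pJ.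
Qed.

Definition dyadic_set : {fset R} := [fset x in map dyadic box]%fset.

Lemma card_dyadic_set : #|` dyadic_set| = (Q * J)%N.
Proof.
have /perm_size -> : perm_eq dyadic_set (map dyadic box).
  apply: uniq_perm; first exact: fset_uniq.
    by rewrite map_inj_uniq ?box_uniq//; exact: dyadic_inj.
  by move=> x; rewrite !inE.
by rewrite size_map size_allpairs !size_iota.
Qed.

Variable B : {fset R}.

Definition indices := [seq p <- box | dyadic p \in B].

Lemma indices_uniq : uniq indices.
Proof. by rewrite filter_uniq ?box_uniq. Qed.

Let pairs (h : nat * nat -> nat) :=
  [seq z <- [seq (p, q) | p <- indices, q <- indices] | h z.1 == h z.2].

Let pairs_uniq h : uniq (pairs h).
Proof.
rewrite filter_uniq//; apply: allpairs_uniq; rewrite ?indices_uniq//.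
by move=> [? ?] [? ?].
Qed.

Let mem_pairs h p q : (p, q) \in pairs h ->
  [/\ h p = h q, p \in box, q \in box, dyadic p \in B & dyadic q \in B].
Proof.
rewrite mem_filter => /andP[/eqP /= hpq] /allpairsP[[p' q'] /= [+ + [ep eq]]].
by rewrite -{}ep -{}eq !mem_filter => /andP[? ?] /andP[? ?].
Qed.

Let dyadic2 (z : (nat * nat) * (nat * nat)) := (dyadic z.1, dyadic z.2).

Let dyadic2_inj : injective dyadic2.
Proof. by move=> [p q] [p' q'] [/dyadic_inj -> /dyadic_inj ->]. Qed.

Let mem_dyadic2 h z : z \in pairs h -> dyadic2 z \in [seq (a, b) | a <- B, b <- B].
Proof.
case: z => p q /mem_pairs[_ _ _ pB qB].
by apply/allpairsP; exists (dyadic p, dyadic q).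
Qed.

(* Differences are counted within each layer 2^k * {1, 3, ..., 2Q-1}. *)
Lemma energy3_add_dyadic :
  (size indices ^ 6 <= J ^ 3 * (4 * Q ^ 2 * J ^ 2) * energy3_add B)%N.
Proof.
pose P := pairs snd.
have hP : (size indices ^ 2 <= J * size P)%N.
  rewrite -(size_iota 0 J); apply: equal_pairs_ge; rewrite ?iota_uniq// => p.
  by rewrite mem_filter mem_box mem_iota => /and3P[].
(* In layer [k] the difference is [2^(k+1) * (i - j)], so [g] determines it. The shift by [Q] keeps
   the subtraction of naturals exact, and [g] takes at most [2 * Q * J] values. *)
pose g (z : (nat * nat) * (nat * nat)) := (z.1.2, z.1.1 + Q - z.2.1)%N.
pose V := [seq (k, d) | k <- iota 0 J, d <- iota 0 (2 * Q)].
have uV : uniq V by apply: allpairs_uniq; rewrite ?iota_uniq// => -[? ?] [? ?].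
have gV : {in P, forall z, g z \in V}.
  move=> [[i k] [j l]] /mem_pairs[_ + _ _ _]; rewrite mem_box => /andP[/= iQ kJ].
  apply/allpairsP; exists (g ((i, k), (j, l))); rewrite !mem_iota /g /=.
  split => //; lia.
have := equal_triples_ge uV gV; rewrite size_allpairs !size_iota => gP.
have PE : (equal_triples g P <= energy3_add B)%N.
  rewrite energy3_addE; pose t := map dyadic2 P.
  apply: (@leq_trans (equal_triples (fun p : R * R => p.1 - p.2) t)); last first.
    apply: equal_triples_sub => //.
    - by rewrite map_inj_uniq// pairs_uniq.
    - by apply: allpairs_uniq; rewrite ?fset_uniq// => -[? ?] [? ?].
    - by move=> x /mapP[z /mem_dyadic2 + ->].
  rewrite equal_triples_map; apply: equal_triples_sub; rewrite ?pairs_uniq//.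
  move=> [[i k] [i' k']] [[j l] [j' l']].
  move=> /mem_pairs[/= kk' + + _ _]; rewrite !mem_box /= => /andP[iQ _] /andP[i'Q _].
  move=> /mem_pairs[/= ll' + + _ _]; rewrite !mem_box /= => /andP[jQ _] /andP[j'Q _].
  rewrite /g /= => -[kl ij]; rewrite /dyadic2 /= !dyadicE -kk' -ll' -kl.
  have {ij} : (i + j' = j + i')%N by lia.
  move=> /(congr1 (fun m : nat => m%:R : R)); rewrite /= !natrD => ij.
  by rewrite -!mulrBl; congr (_ * _); lra.
apply: (@leq_trans ((J * size P) ^ 3)%N); first by rewrite (expnM _ 2 3) leq_exp2r.
rewrite expnMn -mulnA leq_mul2l; apply/orP; right.
apply: (leq_trans gP); apply: leq_mul => //.
by rewrite !expnMn; lia.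
Qed.

(* Only the ratios 2^v, |v| < J, are counted. *)
Lemma energy3_mul_dyadic :
  exists2 E : nat, (E%:R%:E <= energy3_mul B)%E &
  (size indices ^ 6 <= Q ^ 3 * (4 * J ^ 2) * E)%N.
Proof.
pose P := pairs fst.
have hP : (size indices ^ 2 <= Q * size P)%N.
  rewrite -(size_iota 0 Q); apply: equal_pairs_ge; rewrite ?iota_uniq// => p.
  by rewrite mem_filter mem_box mem_iota => /and3P[].
pose g (z : (nat * nat) * (nat * nat)) := (z.1.2 + J - z.2.2)%N.
pose V := iota 0 (2 * J).
have uV : uniq V by exact: iota_uniq.
have gV : {in P, forall z, g z \in V}.
  move=> [[i k] [j l]] /mem_pairs[_ + _ _ _]; rewrite mem_box => /andP[/= iQ kJ].
  rewrite mem_iota /g /=; lia.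
(* The value [v] of [g] stands for the ratio [2^(v - J)]; [J] is the shift in [g]. *)
pose lam (v : nat) : R := 2 ^+ v / 2 ^+ J.
have two0 (k : nat) : 2 ^+ k != 0 :> R by rewrite expf_neq0.
have lam_inj : injective lam.
  move=> v w /(mulIf (invr_neq0 (two0 J)))/eqP.
  by rewrite -!natrX eqr_nat eqn_exp2l// => /eqP.
exists (\sum_(l <- map lam V) mult_rep B l ^ 3)%N.
  apply: energy3_mul_ge; first by rewrite map_inj_uniq.
  by move=> _ /mapP[v _ ->]; rewrite mulf_neq0 ?invr_neq0.
apply: (@leq_trans ((Q * size P) ^ 3)%N); first by rewrite (expnM _ 2 3) leq_exp2r.
rewrite expnMn -mulnA leq_mul2l; apply/orP; right.
have := equal_triples_ge uV gV; rewrite size_iota => gP.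
apply: (leq_trans gP); rewrite expnMn leq_mul2l; apply/orP; right.
rewrite (equal_triplesE uV gV) big_map; apply: leq_sum => v _.
rewrite leq_exp2r// /mult_rep card_fset_filter (seq.permP (perm_fset_prod _ _)).
rewrite -!size_filter -(size_map dyadic2).
apply: uniq_leq_size => [|_ /mapP[[[i k] [j l]] + ->]].
  by rewrite map_inj_uniq// filter_uniq ?pairs_uniq.
rewrite mem_filter => /andP[/eqP gv pqP]; rewrite mem_filter (mem_dyadic2 pqP) andbT.
have [/= ij + + _ _] := mem_pairs pqP; rewrite !mem_box /= => /andP[_ kJ] /andP[_ lJ].
rewrite /g /= in gv; rewrite /lam mulrAC -(inj_eq (mulIf (two0 J))) divfK//.
rewrite !dyadicE ij -mulrA -exprD mulrCA -exprD.
by apply/eqP; congr (_ * 2 ^+ _); lia.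
Qed.
End DyadicDilates.

(** The choice [Q = J^3] makes both energy bounds read [s^6 <= 4 * J^11 * E]. One of [B] and [C] has
    at least half of the [J^4] indices, so [E >= (J^4 / 2)^6 / (4 * J^11) = J^13 / 256], where
    [J^13] is the cardinality to the power [4 - 3/4]. *)
Lemma dyadic_energy_lower (R : realType) (J : nat) (B C : {fset R}) :
  (0 < J)%N -> (B `|` C)%fset = dyadic_set R J (J ^ 3) ->
  (((J ^ 13)%:R / 256)%:E <= Order.max (energy3_add B)%:R%:E (energy3_mul C))%E.
Proof.
move=> J0 BC.
have card_box : size (box J (J ^ 3)) = (J ^ 4)%N.
  by rewrite size_allpairs !size_iota -expnSr.
have : (J ^ 4 <= size (indices J (J ^ 3) B) + size (indices J (J ^ 3) C))%N.
  rewrite !size_filter -count_predUI -card_box -[leqLHS]count_predT.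
  apply: leq_trans (leq_addr _ _); rewrite -!size_filter.
  apply: uniq_leq_size => [|p]; first by rewrite filter_uniq ?box_uniq.
  rewrite !mem_filter /= => pb; rewrite pb andbT.
  have : dyadic R p \in dyadic_set R J (J ^ 3) by rewrite !inE map_f.
  by rewrite -BC in_fsetU.
have large s E : (J ^ 4 <= 2 * s)%N -> (s ^ 6 <= 4 * J ^ 11 * E)%N ->
    (J ^ 13)%:R / 256 <= E%:R :> R.
  move=> hs hE; rewrite ler_pdivrMr ?ltr0n// -natrM ler_nat.
  have J11 : (0 < J ^ 11)%N by rewrite expn_gt0 J0.
  rewrite -(leq_pmul2l J11) -expnD (expnM _ 4 6).
  apply: (@leq_trans ((2 * s) ^ 6)%N); first by rewrite leq_exp2r.
  rewrite expnMn; apply: (@leq_trans (2 ^ 6 * (4 * J ^ 11 * E))%N).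
    by rewrite leq_mul2l hE orbT.
  by rewrite leq_eqVlt; apply/orP; left; apply/eqP; ring.
set b := size _; set c := size _ => bc; rewrite le_max.
have [hb|hb] := leqP (J ^ 4) (2 * b).
  apply/orP; left; rewrite lee_fin; apply: large hb _.
  apply: leq_trans (energy3_add_dyadic _ _ _) _.
  by rewrite -expnM [leqRHS](_ : _ = J ^ 3 * (4 * J ^ (3 * 2) * J ^ 2) * energy3_add B)%N//; ring.
have hc : (J ^ 4 <= 2 * c)%N by lia.
apply/orP; right.
have [E hE hcE] := energy3_mul_dyadic J (J ^ 3) C.
apply: le_trans hE; rewrite lee_fin; apply: large hc _.
apply: leq_trans hcE _.
by rewrite -expnM [leqRHS](_ : _ = J ^ (3 * 3) * (4 * J ^ 2) * E)%N//; ring.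
Qed.

(** With [a = theta / (c + 1)], raising [u * a <= expR (u * a)] to the power [c + 1] gives one power
    of [u] more than needed; [u] is then chosen beyond [|W| / a^(c + 1)]. *)
Lemma exp_beats_power (R : realType) (W c theta : R) :
  0 < c -> 0 < theta ->
  exists u : nat, (0 < u)%N /\ W * u%:R `^ c < expR (u%:R * theta).
Proof.
move=> c0 t0; pose a := theta / (c + 1).
have a0 : 0 < a by rewrite divr_gt0// addr_gt0.
have p0 : 0 < a `^ (c + 1) by exact: powR_gt0.
pose u := (Num.truncn (`|W| / a `^ (c + 1))).+1.
have hu : `|W| / a `^ (c + 1) < u%:R by exact: truncnS_gt.
exists u; split => //.
have u0 : 0 < u%:R :> R by rewrite ltr0n.
apply: (@lt_le_trans _ _ ((u%:R * a) `^ (c + 1))).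
  rewrite powRM ?(ltW u0) ?(ltW a0)// powRD ?(gt_eqF u0) ?implybT//.
  rewrite powRr1 ?(ltW u0)// -mulrA mulrC ltr_pM2l ?powR_gt0//.
  rewrite ltr_pdivrMr// in hu; exact: le_lt_trans (ler_norm _) hu.
rewrite [leRHS](_ : _ = expR (u%:R * a) `^ (c + 1)); last first.
  rewrite /powR gt_eqF ?expR_gt0// expRK; congr expR.
  by rewrite /a; field; rewrite gt_eqF// addr_gt0.
have c1 : 0 <= c + 1 by rewrite addr_ge0// ltW.
have ua0 : 0 <= u%:R * a by rewrite mulr_ge0 ?ltW.
rewrite (ge0_ler_powR c1) ?nnegrE ?expR_ge0//.
by apply: le_trans (expR_ge1Dx _); rewrite lerDr.
Qed.

Lemma no_better_decomposition (R : realType) (delta K c : R) :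
  3 / 4 < delta -> 0 < K -> 0 < c ->
  exists A : {fset R}, (2 <= #|` A|)%N /\
    forall B C : {fset R},
      (B `|` C)%fset = A -> [disjoint B & C]%fset ->
      ((K * (#|` A|%:R `^ (4 - delta)) * (log2 (#|` A|%:R : R)) `^ c)%:E <
       Order.max (energy3_add B)%:R%:E (energy3_mul C))%E.
Proof.
move=> hd K0 c0.
have l2 : 0 < ln 2 :> R by rewrite ln_gt0// ltr1n.
have th : 0 < (4 * delta - 3) * ln 2 by rewrite mulr_gt0//; lra.
(* For [J = 2^u] the cardinality is [2^(4u)] and its logarithm [4u]. The claim becomes [256 * K *
   (4u)^c < 2^(u * (4 * delta - 3))], whose exponent is positive because [delta > 3/4]. *)
have [u [u0 hu]] := exp_beats_power (256 * K * 4 `^ c) c0 th.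
pose J := (2 ^ u)%N; have J0 : (0 < J)%N by rewrite expn_gt0.
have cA : #|` dyadic_set R J (J ^ 3)| = (2 ^ (4 * u))%N.
  by rewrite card_dyadic_set -expnSr -expnM mulnC.
exists (dyadic_set R J (J ^ 3)); rewrite cA; split.
  by rewrite -{1}(expn1 2) leq_exp2l// muln_gt0.
move=> B C BC _; apply: lt_le_trans (dyadic_energy_lower J0 BC); rewrite lte_fin.
have lg : log2 (2 ^ (4 * u))%:R = 4 * u%:R :> R.
  by rewrite /log2 natrX lnXn// -(mulr_natl (ln 2)) mulfK ?gt_eqF// natrM.
have p2 k x : (2 ^ k)%:R `^ x = expR (k%:R * x * ln 2) :> R.
  rewrite /powR gt_eqF ?ltr0n ?expn_gt0// natrX lnXn// -(mulr_natl (ln 2)).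
  by congr expR; ring.
rewrite lg powRM// p2 ltr_pdivlMr// -expnM.
have -> : (2 ^ (u * 13))%:R = expR (u%:R * 13 * ln 2) :> R.
  by rewrite -[LHS]powRr1 ?ler0n// p2 mulr1 natrM.
have -> : u%:R * 13 * ln 2 = (4 * u)%:R * (4 - delta) * ln 2 +
   u%:R * ((4 * delta - 3) * ln 2) :> R by rewrite natrM; ring.
rewrite expRD; set X := expR ((4 * u)%:R * _ * _).
have X0 : 0 < X by exact: expR_gt0.
rewrite -(ltr_pM2l X0) in hu; apply: le_lt_trans hu.
by rewrite le_eqVlt; apply/orP; left; apply/eqP; ring.
Qed.

Theorem theorem3 (R : realType) :
  (exists K c : R, 0 < K /\ 0 < c /\
    forall A : {fset R}, (2 <= #|` A|)%N ->
      exists B C : {fset R},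
        [/\ (B `|` C)%fset = A, [disjoint B & C]%fset &
          (Order.max (energy3_add B)%:R%:E (energy3_mul C) <=
           (K * (#|` A|%:R `^ (4 - 2 / 5)) * (log2 (#|` A|%:R : R)) `^ c)%:E)%E])
  /\
  (forall delta K c : R, 3 / 4 < delta -> 0 < K -> 0 < c ->
    exists A : {fset R}, (2 <= #|` A|)%N /\
      forall B C : {fset R},
        (B `|` C)%fset = A -> [disjoint B & C]%fset ->
          ((K * (#|` A|%:R `^ (4 - delta)) * (log2 (#|` A|%:R : R)) `^ c)%:E <
           Order.max (energy3_add B)%:R%:E (energy3_mul C))%E).
Proof.
split; last exact: no_better_decomposition.
exists (2 ^+ 26), 5; split; first exact: exprn_gt0.
by split => // A; exact: decomposition_exists.
Qed.
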